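(* Let $m,n$ be positive integers. The selfinjective Nakayama algebra $A=N_n^m(\Bbbk)$ is a UMP algebra if and only if $A=N_n^1(\Bbbk)$.
   Context: $\Bbbk$ is an algebraically closed field. For positive integers $m,n$, $N_n^m(\Bbbk)=\Bbbk\Delta_n/I_{n,m}$, where $\Delta_n$ is the cyclic quiver with vertices $1,\dots,n$ and arrows $\alpha_i:i\to i+1$ for $1\le i\le n-1$ and $\alpha_n:n\to 1$, and $I_{n,m}$ is the admissible ideal of $\Bbbk\Delta_n$ generated by all compositions of $m+1$ consecutive arrows in $\Delta_n$. UMP algebras: let $A=\Bbbk Q/I$ be a bound quiver algebra ($Q$ a finite connected quiver with arrow set $Q_1$, $I$ an admissible ideal). For a path $\mathfrak m$ of $Q$, $\mathfrak m+I$ is a maximal path of $A$ if $\mathfrak m\notin I$ and $\alpha\mathfrak m\in I$ and $\mathfrak m\alpha\in I$ for every arrow $\alpha\in Q_1$ (products of non-composable paths are $0$). Two paths of $Q$ are disjoint if they have no common nontrivial subpath. Two maximal paths $\mathfrak m+I$, $\mathfrak m'+I$ are disjoint if any path $w$ of $Q$ representing $\mathfrak m+I$ and any path $w'$ of $Q$ representing $\mathfrak m'+I$ are disjoint. $A$ is a UMP algebra if any two different maximal paths of $A$ are disjoint.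
   Formalization: The claim is stated for n ≥ 2 only: for n = 1 and m ≥ 2 the algebra k[x]/(x^{m+1}) has a single maximal path, so it is UMP without being N_1^1(k); ''A = N_n^1(k)'' is read as isomorphism of k-algebras. *)

(* Defs.v *)
From HB Require Import structures.
From mathcomp Require Import all_boot all_order all_algebra.
From mathcomp Require Import finmap.
From mathcomp Require Import boolp classical_sets.
From mathcomp.multinomials Require Import monalg.

Set Implicit Arguments.
Unset Strict Implicit.
Unset Printing Implicit Defensive.

Import GRing.Theory.
Import Quotient.
Local Open Scope quotient_scope.
Local Open Scope ring_scope.

Record quiver := Quiver {
  vertex : finType;
  arrow : finType;
  source : arrow -> vertex;
  target : arrow -> vertex;
  quiver_nonempty : (0 < #|vertex|)%N;
  quiver_connected : forall u v : vertex,
    connect (fun x y => [exists a, ((source a == x) && (target a == y))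
                                || ((source a == y) && (target a == x))]) u v
}.

(* A path is a starting vertex together with a list of consecutive arrows,
   read from left to right; the starting vertex distinguishes the trivial
   paths. *)
Section Paths.
Variable Q : quiver.

Fixpoint composable (v : vertex Q) (s : seq (arrow Q)) : bool :=
  if s is a :: s' then (source a == v) && composable (target a) s' else true.

Record qpath := QPath {
  path_val :> vertex Q * seq (arrow Q);
  path_valP : composable path_val.1 path_val.2
}.

HB.instance Definition _ := [isSub for path_val].
HB.instance Definition _ := [Choice of qpath by <:].

Definition psource (p : qpath) : vertex Q := (path_val p).1.
Definition parrows (p : qpath) : seq (arrow Q) := (path_val p).2.
Definition ptarget (p : qpath) : vertex Q :=
  last (psource p) [seq target a | a <- parrows p].
Definition plength (p : qpath) : nat := size (parrows p).

Definition trivial_path (v : vertex Q) : qpath :=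
  @QPath (v, [::]) isT.

Fact arrow_path_subproof (a : arrow Q) :
  composable (source a, [:: a]).1 (source a, [:: a]).2.
Proof. by rewrite /= eqxx. Qed.

Definition arrow_path (a : arrow Q) : qpath := QPath (arrow_path_subproof a).

(* The composite "first p, then q", when it exists. *)
Definition pcomp (p q : qpath) : option qpath :=
  if ptarget p == psource q then insub (psource p, parrows p ++ parrows q)
  else None.

Definition subpath (q p : qpath) : Prop :=
  exists u v : qpath, obind (pcomp u) (pcomp q v) = Some p.

Definition disjoint_paths (p p' : qpath) : Prop :=
  ~ exists q : qpath, [/\ (0 < plength q)%N, subpath q p & subpath q p'].

Lemma composable_cat v s t : composable v (s ++ t) =
  composable v s && composable (last v [seq target a | a <- s]) t.
Proof. by elim: s v => //= a s IH v; rewrite IH andbA. Qed.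

Lemma pcompP p q : ptarget p = psource q ->
  exists r, [/\ pcomp p q = Some r, psource r = psource p
              & parrows r = parrows p ++ parrows q].
Proof.
move=> e; rewrite /pcomp e eqxx.
have h : composable (psource p, parrows p ++ parrows q).1
                    (psource p, parrows p ++ parrows q).2.
  by rewrite /= composable_cat path_valP /= -/(ptarget p) e path_valP.
by rewrite insubT; exists (QPath h).
Qed.

Lemma pcompN p q : ptarget p != psource q -> pcomp p q = None.
Proof. by rewrite /pcomp => /negbTE ->. Qed.

Lemma qpath_eq (p q : qpath) :
  psource p = psource q -> parrows p = parrows q -> p = q.
Proof.
move=> h1 h2; apply/val_inj => /=; move: h1 h2; rewrite /psource /parrows.
by case: (path_val p) (path_val q) => [? ?] [? ?] /= -> ->.
Qed.

Lemma ptarget_comp p q r : pcomp p q = Some r -> ptarget r = ptarget q.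
Proof.
have [e|/pcompN -> //] := eqVneq (ptarget p) (psource q).
have [r' [-> h1 h2] [<-]] := pcompP e.
by rewrite /ptarget h1 h2 map_cat last_cat -/(ptarget p) e.
Qed.

Lemma psource_comp p q r : pcomp p q = Some r -> psource r = psource p.
Proof.
have [e|/pcompN -> //] := eqVneq (ptarget p) (psource q).
by have [r' [-> h1 h2] [<-]] := pcompP e.
Qed.

Lemma parrows_comp p q r :
  pcomp p q = Some r -> parrows r = parrows p ++ parrows q.
Proof.
have [e|/pcompN -> //] := eqVneq (ptarget p) (psource q).
by have [r' [-> h1 h2] [<-]] := pcompP e.
Qed.

Lemma pcompA p q r :
  obind (pcomp p) (pcomp q r) = obind (fun s => pcomp s r) (pcomp p q).
Proof.
have [e1|n1] := eqVneq (ptarget p) (psource q); last first.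
  rewrite (pcompN n1) /=; case E: (pcomp q r) => [s|] //=.
  by rewrite pcompN // (psource_comp E).
have [s [Es s1 s2]] := pcompP e1; rewrite Es /=.
have [e2|n2] := eqVneq (ptarget q) (psource r); last first.
  by rewrite (pcompN n2) /= pcompN // (ptarget_comp Es).
have [t [Et t1 t2]] := pcompP e2; rewrite Et /=.
have /pcompP[x [-> x1 x2]] : ptarget p = psource t by rewrite t1.
have /pcompP[y [-> y1 y2]] : ptarget s = psource r by rewrite (ptarget_comp Es).
congr Some; apply: qpath_eq; first by rewrite x1 y1 s1.
by rewrite x2 y2 s2 t2 catA.
Qed.

Lemma pcomp1p v p :
  pcomp (trivial_path v) p = if v == psource p then Some p else None.
Proof.
have [->|n] := eqVneq v (psource p); last exact: pcompN.
have [|r [-> r1 r2]] := @pcompP (trivial_path (psource p)) p; first by [].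
by congr Some; apply: qpath_eq.
Qed.

Lemma pcompp1 v p :
  pcomp p (trivial_path v) = if ptarget p == v then Some p else None.
Proof.
have [<-|n] := eqVneq (ptarget p) v; last exact: pcompN.
have [|r [-> r1 r2]] := @pcompP p (trivial_path (ptarget p)); first by [].
by congr Some; apply: qpath_eq; rewrite // r2 cats0.
Qed.

End Paths.

Section LinearExtension.
Variables (k : fieldType) (K : choiceType) (V : lmodType k).
Implicit Types (F : K -> V) (x y : {malg k[K]}).

Definition lext F x : V := \sum_(p <- msupp x) x@_p *: F p.

Lemma lextw F x (d : {fset K}) : (msupp x `<=` d)%fset ->
  lext F x = \sum_(p <- d) x@_p *: F p.
Proof.
move=> h; rewrite /lext (big_fset_incl _ h) // => p _ hp.
by rewrite mcoeff_outdom // scale0r.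
Qed.

Lemma lextP F c x y : lext F (c *: x + y) = c *: lext F x + lext F y.
Proof.
pose d := (msupp x `|` msupp y `|` msupp (c *: x + y))%fset.
have hx : (msupp x `<=` d)%fset by rewrite /d -fsetUA fsubsetUl.
have hy : (msupp y `<=` d)%fset.
  by rewrite /d fsetUAC fsubsetUr.
have hxy : (msupp (c *: x + y) `<=` d)%fset by rewrite /d fsubsetUr.
rewrite (lextw F hx) (lextw F hy) (lextw F hxy) scaler_sumr -big_split /=.
by apply: eq_bigr => p _; rewrite mcoeffD mcoeffZ scalerDl scalerA.
Qed.

Lemma lextU F p : lext F << p >> = F p.
Proof.
by rewrite (lextw F msuppU_le) big_seq_fset1 mcoeffUU scale1r.
Qed.

Lemma malg_basis (P : {malg k[K]} -> Prop) : P 0 ->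
  (forall c x y, P x -> P y -> P (c *: x + y)) -> (forall p, P << p >>) ->
  forall x, P x.
Proof.
move=> P0 PL PU x; rewrite (monalgE x).
elim/big_rec: _ => // p y _ Py.
suff -> : << x@_p *g p >> = x@_p *: << p >> by apply: PL.
by apply/malgP => q; rewrite mcoeffZ !mcoeffU mulrnAr mulr1.
Qed.

End LinearExtension.

(* The path algebra kQ: finitely supported functions from paths to k. *)
Definition path_algebra (k : fieldType) (Q : quiver) := {malg k[qpath Q]}.

HB.instance Definition _ (k : fieldType) (Q : quiver) :=
  GRing.Lmodule.on (path_algebra k Q).

(* Locked to keep unification from unfolding the finitely supported function. *)
HB.lock Definition of_path (k : fieldType) (Q : quiver) (p : qpath Q) :
  path_algebra k Q := << p >>.

Definition path_mul (k : fieldType) (Q : quiver) (p q : qpath Q) :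
    path_algebra k Q :=
  if pcomp p q is Some r then of_path k r else 0.

HB.lock Definition pa_mul (k : fieldType) (Q : quiver)
    (x y : path_algebra k Q) : path_algebra k Q :=
  \sum_(p <- msupp x) \sum_(q <- msupp y) (x@_p * y@_q) *: path_mul k p q.

Section PathAlgebra.
Variables (k : fieldType) (Q : quiver).
Local Notation kQ := (path_algebra k Q).
Implicit Types (x y z : kQ) (p q r : qpath Q).

Local Notation of_path := (of_path k).
Local Notation path_mul := (path_mul k).
Local Notation pa_mul := (@pa_mul k Q).

Lemma of_pathE p : of_path p = << p >>. Proof. by rewrite of_path.unlock. Qed.

Lemma path_basis (P : kQ -> Prop) : P 0 ->
  (forall c x y, P x -> P y -> P (c *: x + y)) -> (forall p, P (of_path p)) ->
  forall x, P x.
Proof.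
by move=> P0 PL PU; apply: malg_basis => // p; rewrite -of_pathE; apply: PU.
Qed.

Lemma mcoeff_of_path p q : (of_path p)@_q = (p == q)%:R.
Proof. by rewrite of_pathE mcoeffU. Qed.

Definition pa_one : kQ := \sum_(v : vertex Q) of_path (trivial_path v).

Lemma pa_mulE x y : pa_mul x y = lext (fun p => lext (path_mul p) y) x.
Proof.
rewrite pa_mul.unlock /lext; apply: eq_bigr => p _; rewrite scaler_sumr.
by apply: eq_bigr => q _; rewrite scalerA.
Qed.

Lemma pa_mulPl c x y z : pa_mul (c *: x + y) z = c *: pa_mul x z + pa_mul y z.
Proof. by rewrite !pa_mulE lextP. Qed.

Lemma pa_mulPr c x y z : pa_mul z (c *: x + y) = c *: pa_mul z x + pa_mul z y.
Proof.
rewrite !pa_mulE /lext scaler_sumr -big_split /=; apply: eq_bigr => p _.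
by rewrite -/(lext _ _) lextP scalerDr scalerA mulrC -scalerA.
Qed.

Lemma pa_mulUU p q : pa_mul (of_path p) (of_path q) = path_mul p q.
Proof. by rewrite pa_mulE !of_pathE !lextU. Qed.

Lemma pa_mul0r x : pa_mul 0 x = 0.
Proof. by have := pa_mulPl (-1) 0 0 x; rewrite !scaleN1r !addNr. Qed.

Lemma pa_mulr0 x : pa_mul x 0 = 0.
Proof. by have := pa_mulPr (-1) 0 0 x; rewrite !scaleN1r !addNr. Qed.

Lemma pa_mulDl : left_distributive pa_mul +%R.
Proof. by move=> x y z; have := pa_mulPl 1 x y z; rewrite !scale1r. Qed.

Lemma pa_mulDr : right_distributive pa_mul +%R.
Proof. by move=> z x y; have := pa_mulPr 1 x y z; rewrite !scale1r. Qed.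

Lemma pa_mulZl c x y : pa_mul (c *: x) y = c *: pa_mul x y.
Proof. by have := pa_mulPl c x 0 y; rewrite (pa_mul0r y) [c *: x + 0]addr0 addr0. Qed.

Lemma pa_mulZr c x y : pa_mul x (c *: y) = c *: pa_mul x y.
Proof.
apply: etrans (etrans (pa_mulPr c y 0 x) _); first by congr pa_mul; rewrite addr0.
by apply: etrans (addr0 _); congr (_ + _); apply: pa_mulr0.
Qed.

Lemma pa_mulA : associative pa_mul.
Proof.
move=> x y z; elim/path_basis: x => [|c x x' e e'|p].
- by rewrite !pa_mul0r.
- by rewrite !pa_mulPl e e'.
elim/path_basis: y => [|c y y' e e'|q].
- by rewrite pa_mul0r pa_mulr0 pa_mul0r.
- by rewrite !(pa_mulPl, pa_mulPr) e e'.
elim/path_basis: z => [|c z z' e e'|r].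
- by rewrite !pa_mulr0.
- by rewrite !pa_mulPr e e'.
rewrite !pa_mulUU.
have := pcompA p q r; rewrite /path_mul.
case: (pcomp q r) => [s|]; case: (pcomp p q) => [t|] /= e;
  by rewrite ?pa_mulUU ?pa_mul0r ?pa_mulr0 // /path_mul ?e // -e.
Qed.

Lemma pa_mul_suml (I : finType) (F : I -> kQ) y :
  pa_mul (\sum_i F i) y = \sum_i pa_mul (F i) y.
Proof.
by apply: (big_morph (pa_mul^~ y)) => [u v|]; rewrite ?pa_mulDl ?pa_mul0r.
Qed.

Lemma pa_mul_sumr (I : finType) (F : I -> kQ) y :
  pa_mul y (\sum_i F i) = \sum_i pa_mul y (F i).
Proof.
by apply: (big_morph (pa_mul y)) => [u v|]; rewrite ?pa_mulDr ?pa_mulr0.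
Qed.

Lemma pa_mul1 : left_id pa_one pa_mul.
Proof.
elim/path_basis => [|c x y e e'|p]; first by rewrite pa_mulr0.
  by rewrite pa_mulPr e e'.
rewrite pa_mul_suml (bigD1 (psource p)) //= big1 => [|v nv];
  by rewrite pa_mulUU /path_mul pcomp1p ?eqxx ?addr0 // (negbTE nv).
Qed.

Lemma pa_mulr1 : right_id pa_one pa_mul.
Proof.
elim/path_basis => [|c x y e e'|p]; first by rewrite pa_mul0r.
  by rewrite pa_mulPl e e'.
rewrite pa_mul_sumr (bigD1 (ptarget p)) //= big1 => [|v nv];
  by rewrite pa_mulUU /path_mul pcompp1 ?eqxx ?addr0 // eq_sym (negbTE nv).
Qed.

Lemma pa_oneE v : pa_one@_(trivial_path v) = 1.
Proof.
rewrite raddf_sum /= (bigD1 v) //= mcoeff_of_path eqxx big1 ?addr0 // => u nu.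
rewrite mcoeff_of_path; case: eqP => // /(congr1 (@psource Q)) /= e.
by rewrite -[u]/(psource (trivial_path u)) e eqxx in nu.
Qed.

Lemma pa_one_neq0 : pa_one != 0.
Proof.
have /card_gt0P[v _] := quiver_nonempty Q.
apply/eqP => /(congr1 (mcoeff (trivial_path v))).
by rewrite pa_oneE mcoeff0 => /eqP; rewrite oner_eq0.
Qed.

HB.instance Definition _ := GRing.Zmodule_isNzRing.Build kQ
  pa_mulA pa_mul1 pa_mulr1 pa_mulDl pa_mulDr pa_one_neq0.

Lemma pa_scaleAl (c : k) x y : c *: (x * y) = (c *: x) * y.
Proof. exact/esym/pa_mulZl. Qed.

Lemma pa_scaleAr (c : k) x y : c *: (x * y) = x * (c *: y).
Proof. exact/esym/pa_mulZr. Qed.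

HB.instance Definition _ := GRing.Lmodule_isLalgebra.Build k kQ pa_scaleAl.
HB.instance Definition _ := GRing.Lalgebra_isAlgebra.Build k kQ pa_scaleAr.

Lemma mul_pathE x y : x * y = pa_mul x y. Proof. by []. Qed.

Lemma mul_of_path p q : of_path p * of_path q = path_mul p q.
Proof. exact: pa_mulUU. Qed.

End PathAlgebra.

Section Ideals.
Variable A : nzRingType.

Definition two_sided_ideal (I : set A) : Prop :=
  [/\ I 0, forall x y, I x -> I y -> I (x - y),
      forall a x, I x -> I (a * x) & forall a x, I x -> I (x * a)].

Definition ideal_gen (S : set A) : set A :=
  fun x => forall J : set A, two_sided_ideal J -> (S `<=` J)%classic -> J x.

Definition ideal_exp (I : set A) (l : nat) : set A :=
  ideal_gen (fun x => exists s : seq A,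
    [/\ size s = l, (forall y, y \in s -> I y) & x = \prod_(y <- s) y]).

Lemma ideal_gen_ideal S : two_sided_ideal (ideal_gen S).
Proof.
split=> [J [h0 _ _ _] _ //|x y hx hy J hJ SJ|a x hx J hJ SJ|a x hx J hJ SJ].
- by have [_ hB _ _] := hJ; apply: hB; [apply: hx | apply: hy].
- by have [_ _ hl _] := hJ; apply: hl; apply: hx.
- by have [_ _ _ hr] := hJ; apply: hr; apply: hx.
Qed.

Lemma ideal_gen_incl S : (S `<=` ideal_gen S)%classic.
Proof. by move=> x Sx J _; apply. Qed.

End Ideals.

Record proper_ideal (A : nzRingType) := ProperIdeal {
  proper_ideal_set :> set A;
  proper_idealP : two_sided_ideal proper_ideal_set;
  proper_ideal1 : ~ proper_ideal_set 1
}.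

(* The library only provides quotients of commutative rings. *)
Section QuotientAlgebra.
Variables (k : fieldType) (A : algType k) (I : proper_ideal A).

Definition ideal_mem : {pred A} := fun x => `[< (I : set A) x >].

Lemma ideal_mem_zmod : zmod_closed ideal_mem.
Proof.
have [h0 hB _ _] := proper_idealP I; split; first exact/asboolP.
by move=> x y /asboolP hx /asboolP hy; apply/asboolP/hB.
Qed.

HB.instance Definition _ := GRing.isZmodClosed.Build A ideal_mem ideal_mem_zmod.

Lemma ideal_memMl a x : x \in ideal_mem -> a * x \in ideal_mem.
Proof.
by have [_ _ h _] := proper_idealP I; move=> /asboolP hx; apply/asboolP/h.
Qed.

Lemma ideal_memMr a x : x \in ideal_mem -> x * a \in ideal_mem.
Proof.
by have [_ _ _ h] := proper_idealP I; move=> /asboolP hx; apply/asboolP/h.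
Qed.

Definition quot_alg := {quot ideal_mem}.

HB.instance Definition _ := GRing.Zmodule.on quot_alg.
HB.instance Definition _ := EqQuotient.on quot_alg.

Definition residue (x : A) : quot_alg := \pi_{quot ideal_mem} x.

Lemma residue_eq x y : (residue x = residue y) <-> (I : set A) (x - y).
Proof.
rewrite /residue; split.
  by move/eqP; rewrite -idealrBE => /asboolP.
by move=> h; apply/eqP; rewrite -idealrBE; apply/asboolP.
Qed.

Definition quot_one : quot_alg := residue 1.
Definition quot_mul (x y : quot_alg) : quot_alg := residue (repr x * repr y).
Definition quot_scale (c : k) (x : quot_alg) : quot_alg := residue (c *: repr x).

Lemma residueK x : residue (repr x) = x. Proof. exact: reprK. Qed.

Lemma residueD x y : residue (x + y) = residue x + residue y.
Proof. by rewrite /residue; apply: (pi_add ideal_mem x y). Qed.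

Lemma repr_residue x : (I : set A) (repr (residue x) - x).
Proof. by apply/residue_eq; rewrite residueK. Qed.

Lemma quot_mulE x y : quot_mul (residue x) (residue y) = residue (x * y).
Proof.
have [_ hB hl hr] := proper_idealP I.
apply/residue_eq; set x' := repr _; set y' := repr _.
have -> : x' * y' - x * y = (x' - x) * y' - x * (y - y').
  by rewrite mulrBl mulrBr opprB addrA subrK.
apply: (hB); [apply: hr; exact: repr_residue | apply: hl].
have [h0 _ _ _] := proper_idealP I.
by rewrite -[y - y']opprB -sub0r; apply: (hB) => //; apply: repr_residue.
Qed.

Lemma quot_scaleE c x : quot_scale c (residue x) = residue (c *: x).
Proof.
apply/residue_eq; rewrite -scalerBr -mulr_algl.
by have [_ _ hl _] := proper_idealP I; apply/hl/repr_residue.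
Qed.

Lemma quot_mulA : associative quot_mul.
Proof.
move=> x y z; rewrite -(residueK x) -(residueK y) -(residueK z).
by rewrite !quot_mulE mulrA.
Qed.

Lemma quot_mul1 : left_id quot_one quot_mul.
Proof. by move=> x; rewrite -(residueK x) quot_mulE mul1r. Qed.

Lemma quot_mulr1 : right_id quot_one quot_mul.
Proof. by move=> x; rewrite -(residueK x) quot_mulE mulr1. Qed.

Lemma quot_mulDl : left_distributive quot_mul +%R.
Proof.
move=> x y z; rewrite -(residueK x) -(residueK y) -(residueK z).
by rewrite -residueD !quot_mulE mulrDl residueD.
Qed.

Lemma quot_mulDr : right_distributive quot_mul +%R.
Proof.
move=> x y z; rewrite -(residueK x) -(residueK y) -(residueK z).
by rewrite -residueD !quot_mulE mulrDr residueD.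
Qed.

Lemma residue0 : residue 0 = 0.
Proof. by apply: (addIr (residue 0)); rewrite -residueD !add0r. Qed.

Lemma quot_one_neq0 : quot_one != 0.
Proof.
apply/eqP; rewrite -residue0 => /residue_eq; rewrite subr0.
exact: proper_ideal1.
Qed.

HB.instance Definition _ := GRing.Zmodule_isNzRing.Build quot_alg
  quot_mulA quot_mul1 quot_mulr1 quot_mulDl quot_mulDr quot_one_neq0.

Lemma quot_scaleA a b x :
  quot_scale a (quot_scale b x) = quot_scale (a * b) x.
Proof. by rewrite -(residueK x) !quot_scaleE scalerA. Qed.

Lemma quot_scale1 : left_id 1 quot_scale.
Proof. by move=> x; rewrite -(residueK x) quot_scaleE scale1r. Qed.

Lemma quot_scaleDr : right_distributive quot_scale +%R.
Proof.
move=> c x y; rewrite -(residueK x) -(residueK y) -residueD !quot_scaleE.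
by rewrite scalerDr residueD.
Qed.

Lemma quot_scaleDl x : {morph quot_scale^~ x : a b / a + b}.
Proof. by move=> a b; rewrite -(residueK x) !quot_scaleE scalerDl residueD. Qed.

HB.instance Definition _ := GRing.Zmodule_isLmodule.Build k quot_alg
  quot_scaleA quot_scale1 quot_scaleDr quot_scaleDl.

Lemma quot_scaleAl (c : k) (x y : quot_alg) : c *: (x * y) = (c *: x) * y.
Proof.
change (quot_scale c (quot_mul x y) = quot_mul (quot_scale c x) y).
by rewrite -(residueK x) -(residueK y) !(quot_mulE, quot_scaleE) scalerAl.
Qed.

Lemma quot_scaleAr (c : k) (x y : quot_alg) : c *: (x * y) = x * (c *: y).
Proof.
change (quot_scale c (quot_mul x y) = quot_mul x (quot_scale c y)).
by rewrite -(residueK x) -(residueK y) !(quot_mulE, quot_scaleE) scalerAr.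
Qed.

HB.instance Definition _ :=
  GRing.Lmodule_isLalgebra.Build k quot_alg quot_scaleAl.
HB.instance Definition _ :=
  GRing.Lalgebra_isAlgebra.Build k quot_alg quot_scaleAr.

End QuotientAlgebra.

Section Admissible.
Variables (k : fieldType) (Q : quiver).
Local Notation kQ := (path_algebra k Q).

Definition arrow_ideal : set kQ :=
  ideal_gen (fun x => exists a : arrow Q, x = of_path k (arrow_path a)).

Definition admissible (I : set kQ) : Prop :=
  [/\ two_sided_ideal I, (I `<=` ideal_exp arrow_ideal 2)%classic
    & exists2 N, (2 <= N)%N & (ideal_exp arrow_ideal N `<=` I)%classic].

Definition long (l : nat) : set kQ :=
  fun x => forall p, (plength p < l)%N -> x@_p = 0.

Lemma long_of_path l (p : qpath Q) : (l <= plength p)%N -> long l (of_path k p).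
Proof.
by move=> h q hq; rewrite mcoeff_of_path; case: eqP hq => // <-; rewrite ltnNge h.
Qed.

Lemma long0 l : long l 0. Proof. by move=> p _; rewrite mcoeff0. Qed.

Lemma longP l c x y : long l x -> long l y -> long l (c *: x + y).
Proof. by move=> hx hy p h; rewrite mcoeffD mcoeffZ hx ?hy // mulr0 addr0. Qed.

Lemma long_mul i j (x y : kQ) : long i x -> long j y -> long (i + j) (x * y).
Proof.
move=> hx hy; rewrite mul_pathE pa_mul.unlock.
have sumP (s : seq (qpath Q)) (F : qpath Q -> kQ) :
    (forall p, p \in s -> long (i + j) (F p)) ->
    long (i + j) (\sum_(p <- s) F p).
  move=> h; rewrite big_seq; elim/big_rec: _ => [|p z hp hz].
    exact: long0.
  by rewrite -[F p]scale1r; apply: longP => //; apply: h.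
apply: (sumP) => p hp; apply: (sumP) => q hq; rewrite -[_ *: _]addr0.
apply: longP; last exact: long0.
rewrite /path_mul; case E: pcomp => [r|]; last exact: long0.
apply: long_of_path; rewrite /plength (parrows_comp E) size_cat leq_add //.
  by rewrite leqNgt; apply/negP => /hx /eqP; rewrite mcoeff_eq0 hp.
by rewrite leqNgt; apply/negP => /hy /eqP; rewrite mcoeff_eq0 hq.
Qed.

Lemma long_ideal l : two_sided_ideal (long l).
Proof.
split=> [|x y hx hy|a x hx|a x hx]; first exact: long0.
- by rewrite -scaleN1r addrC; apply: longP.
- by rewrite -[l]add0n; apply: long_mul.
- by rewrite -[l]addn0; apply: long_mul.
Qed.

Lemma arrow_ideal_long : (arrow_ideal `<=` long 1)%classic.
Proof.
move=> x; apply; first exact: long_ideal.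
by move=> _ [a ->]; apply: long_of_path.
Qed.

Lemma arrow_ideal_exp_long l : (ideal_exp arrow_ideal l `<=` long l)%classic.
Proof.
move=> x; apply; first exact: long_ideal.
move=> _ [s [<- hs ->]]; elim: s hs => [|y s IH] hs; first by rewrite big_nil.
rewrite big_cons -[size _]add1n; apply: long_mul.
  by apply: arrow_ideal_long; apply: (hs y); apply: mem_head.
by apply: IH => z hz; apply: hs; rewrite in_cons hz orbT.
Qed.

Lemma admissible_not1 (I : set kQ) : admissible I -> ~ I 1.
Proof.
case=> _ hI _ /hI /arrow_ideal_exp_long h1.
have /card_gt0P[v _] := quiver_nonempty Q.
have /eqP := h1 (trivial_path v) isT.
by move: (pa_oneE k v) => ->; rewrite oner_eq0.
Qed.

Lemma path_prod (p : qpath Q) : (0 < plength p)%N ->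
  of_path k p = \prod_(a <- parrows p) of_path k (arrow_path a).
Proof.
case: p => -[v s] /=; rewrite /plength /parrows /=.
case: s => //= a s; elim: s a v => [|b s IH] a v h _.
  rewrite big_seq1; congr of_path; apply: qpath_eq => //.
  by have /andP[/eqP e _] := h; rewrite /psource /= e.
have h' : composable (source b, b :: s).1 (source b, b :: s).2.
  by move: h => /= /andP[_ /andP[_ ->]]; rewrite eqxx.
rewrite big_cons -(IH b (source b) h' isT).
rewrite mul_of_path /path_mul.
have /pcompP[r [-> r1 r2]] :
    ptarget (arrow_path a) = psource (QPath h').
  by have /= /and3P[_ /eqP e _] := h; rewrite /psource /= e.
congr of_path; apply: qpath_eq; rewrite ?r1 ?r2 //=.
by have /andP[/eqP e _] := h; rewrite /psource /= e.
Qed.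

Definition paths_ideal (l : nat) : set kQ :=
  ideal_gen (fun x => exists2 p : qpath Q, plength p = l & x = of_path k p).

Lemma long_paths_ideal l : (long l `<=` paths_ideal l)%classic.
Proof.
have [h0 hB hl hr] := ideal_gen_ideal
  (fun x => exists2 p : qpath Q, plength p = l & x = of_path k p).
have hZD c (x y : kQ) : paths_ideal l x -> paths_ideal l y ->
    paths_ideal l (c *: x + y).
  move=> hx hy; rewrite -[y]opprK; apply: (hB).
    by rewrite -mulr_algl; apply: hl.
  by rewrite -sub0r; apply: (hB).
have hp p : (l <= plength p)%N -> paths_ideal l (of_path k p).
  move=> lp; have := path_valP p.
  rewrite -/(psource p) -/(parrows p) -(cat_take_drop l (parrows p)).
  rewrite composable_cat => /andP[c1 c2].
  pose p1 := @QPath Q (psource p, take l (parrows p)) c1.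
  pose p2 := @QPath Q (ptarget p1, drop l (parrows p)) c2.
  suff -> : of_path k p = of_path k p1 * of_path k p2.
    apply: hr; apply: ideal_gen_incl; exists p1 => //.
    by rewrite /plength /= size_takel.
  rewrite mul_of_path /path_mul.
  have /pcompP[r [-> r1 r2]] : ptarget p1 = psource p2 by [].
  by congr of_path; apply: qpath_eq; rewrite ?r1 // r2 cat_take_drop.
move=> x lx; rewrite (monalgE x) big_seq; elim/big_rec: _ => // p y px hy.
have -> : << x@_p *g p >> = x@_p *: of_path k p :> kQ.
  by apply/malgP => q; rewrite mcoeffZ mcoeff_of_path mcoeffU mulr_natr.
apply: hZD => //; apply: hp; rewrite leqNgt; apply/negP => /lx /eqP.
by rewrite mcoeff_eq0 px.
Qed.

Lemma paths_ideal_admissible m : (0 < m)%N -> admissible (paths_ideal m.+1).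
Proof.
move=> m0; split; first exact: ideal_gen_ideal.
  move=> x; apply; first exact: ideal_gen_ideal.
  move=> _ [p lp ->]; rewrite path_prod ?lp //.
  move: lp; rewrite /plength; case: (parrows p) => // a [|b s] //.
    by case: m m0.
  move=> _; rewrite !big_cons mulrA.
  have [_ _ _ hr] := ideal_gen_ideal (fun x : kQ => exists s : seq kQ,
    [/\ size s = 2, (forall y, y \in s -> arrow_ideal y)
      & x = \prod_(y <- s) y]).
  apply: hr; apply: ideal_gen_incl.
  exists [:: of_path k (arrow_path a); of_path k (arrow_path b)].
  split=> //; last by rewrite big_cons big_seq1.
  by move=> y; rewrite !inE => /orP[] /eqP ->;
    apply: ideal_gen_incl; [exists a | exists b].
by exists m.+1 => // x /arrow_ideal_exp_long /long_paths_ideal.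
Qed.

End Admissible.

Record bound_quiver (k : fieldType) := BoundQuiver {
  bq_quiver : quiver;
  bq_ideal : set (path_algebra k bq_quiver);
  bq_admissible : admissible bq_ideal
}.

Arguments bq_ideal {k} b.

Section BoundQuiverAlgebra.
Variables (k : fieldType) (A : bound_quiver k).
Local Notation Q := (bq_quiver A).

Fact bq_ideal_ideal : two_sided_ideal (bq_ideal A).
Proof. by case: (bq_admissible A). Qed.

Definition bq_proper_ideal : proper_ideal (path_algebra k Q) :=
  ProperIdeal bq_ideal_ideal (admissible_not1 (bq_admissible A)).

Definition bq_algebra : algType k := quot_alg bq_proper_ideal.

Definition path_class (p : qpath Q) : bq_algebra :=
  residue bq_proper_ideal (of_path k p).

Definition is_maximal_path (p : qpath Q) : Prop :=
  ~ bq_ideal A (of_path k p) /\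
  forall a : arrow Q,
    bq_ideal A (of_path k (arrow_path a) * of_path k p) /\
    bq_ideal A (of_path k p * of_path k (arrow_path a)).

Definition disjoint_classes (p p' : qpath Q) : Prop :=
  forall w w' : qpath Q,
    path_class w = path_class p -> path_class w' = path_class p' ->
    disjoint_paths w w'.

Definition is_UMP : Prop :=
  forall p p' : qpath Q, is_maximal_path p -> is_maximal_path p' ->
    path_class p <> path_class p' -> disjoint_classes p p'.

End BoundQuiverAlgebra.

Arguments path_class {k} A p.
Arguments is_maximal_path {k} A p.
Arguments disjoint_classes {k} A p p'.

Definition alg_isomorphic (k : fieldType) (A B : algType k) : Prop :=
  exists f : {lrmorphism A -> B}, bijective f.

Section Nakayama.
Variables (n : nat) (n_gt0 : (0 < n)%N).

Fact cyclic_nonempty : (0 < #|'I_n|)%N. Proof. by rewrite card_ord. Qed.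

Fact cyclic_connected (u v : 'I_n) :
  connect (fun x y : 'I_n => [exists a : 'I_n, ((a == x) && (ordS a == y))
                                 || ((a == y) && (ordS a == x))]) u v.
Proof.
set e := (X in connect X).
have es : symmetric e.
  by move=> x y; apply/existsP/existsP => -[a h]; exists a; rewrite orbC.
pose o := Ordinal n_gt0.
suff h (w : 'I_n) : connect e o w.
  by apply: connect_trans (h v); rewrite (sym_connect_sym es) h.
case: w => i; elim: i => [|i IH] hi.
  by rewrite (_ : Ordinal hi = o) //; apply: val_inj.
apply: connect_trans (IH (ltnW hi)) _; apply: connect1; apply/existsP.
exists (Ordinal (ltnW hi)); rewrite eqxx /=; apply/orP; left.
by apply/eqP/val_inj; rewrite /= modn_small.
Qed.

(* The vertices and the arrows are numbered from 0 to n - 1 and the successor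
   ordS is taken modulo n, so that arrow n - 1 goes back to vertex 0. *)
Definition cyclic_quiver : quiver :=
  @Quiver 'I_n 'I_n id (@ordS n) cyclic_nonempty cyclic_connected.

Definition nakayama (k : fieldType) (m : nat) (m_gt0 : (0 < m)%N) :
    bound_quiver k :=
  BoundQuiver (@paths_ideal_admissible k cyclic_quiver m m_gt0).

End Nakayama.

(* Main.v *)
Require Import Defs.
From mathcomp Require Import all_boot all_algebra.
From mathcomp Require Import monalg.

(** The ideal generated by the paths of length [l] consists of the elements
    supported on paths of length at least [l], so a path lying outside it is the
    only path in its residue class.  If [1 < m], the paths of length [m] starting
    at the vertices 0 and 1 are distinct maximal paths sharing the arrow 1; if
    [m = 1], all maximal paths have length at most one, hence are disjoint.
    An isomorphism with the algebra for [m = 1] forces [m = 1]: there, elements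
    of square zero have no component on the trivial paths, so the product of any
    two of them vanishes, whereas the arrows 0 and 1 square to zero
    (as [1 < n]) and their product vanishes only if [m < 2]. *)

Set Implicit Arguments.
Unset Strict Implicit.

Import GRing.Theory.
Local Open Scope ring_scope.

(* [pcomp] would otherwise denote the composition of partial functions. *)
Local Notation pcomp := Defs.pcomp.

Section TruncatedQuiver.
Variables (k : fieldType) (Q : quiver).
Local Notation kQ := (path_algebra k Q).
Implicit Types (x y : kQ) (p q : qpath Q).

Lemma paths_idealP l x : paths_ideal l x <-> long l x.
Proof.
split; last exact: long_paths_ideal.
apply; first exact: long_ideal.
by move=> _ [p lp ->]; apply: long_of_path; rewrite lp.
Qed.

Lemma of_path_paths_ideal l p : paths_ideal l (of_path k p) <-> (l <= plength p)%N.
Proof.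
split=> [/paths_idealP h|h]; last exact/paths_idealP/long_of_path.
rewrite leqNgt; apply/negP => /h /eqP.
by rewrite mcoeff_of_path eqxx oner_eq0.
Qed.

(** A composite of two paths is trivial only when both factors are that same trivial path;
    bilinearity reduces the claim to paths. *)
Lemma mcoeff_mul_trivial x y v :
  (x * y)@_(trivial_path v) = x@_(trivial_path v) * y@_(trivial_path v).
Proof.
elim/path_basis: x => [|c x x' e e'|p]; first by rewrite !mul0r mcoeff0 mul0r.
  by rewrite mul_pathE pa_mulPl !mcoeffD !mcoeffZ e e' mulrDl mulrA.
elim/path_basis: y => [|c y y' e e'|q]; first by rewrite !mulr0 mcoeff0 mulr0.
  by rewrite mul_pathE pa_mulPr !mcoeffD !mcoeffZ e e' mulrDr mulrCA.
rewrite mul_of_path /path_mul !mcoeff_of_path -natrM mulnb.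
case E: (pcomp p q) => [r|].
  rewrite mcoeff_of_path; congr (nat_of_bool _)%:R.
  apply/eqP/andP => [rv|[/eqP pv /eqP qv]].
    have := parrows_comp E; rewrite rv.
    case Ep: (parrows p) => //; case Eq: (parrows q) => // _.
    have pv : p = trivial_path v.
      by apply: qpath_eq; rewrite // -(psource_comp E) rv.
    split; first exact/eqP.
    move: E; rewrite rv pv pcomp1p; case: eqVneq => // vq [->].
    exact: eqxx.
  by move: E; rewrite pv qv pcomp1p eqxx => -[].
rewrite mcoeff0; case: eqP => // pv; case: eqP => // qv.
by move: E; rewrite pv qv pcomp1p eqxx.
Qed.

Lemma long_sqr_eq0 x : long 2 (x * x) -> long 1 x.
Proof.
move=> h p; rewrite ltnS leqn0 => /eqP/size0nil pp.
have -> : p = trivial_path (psource p) by apply: qpath_eq.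
have := h (trivial_path (psource p)) isT.
by rewrite mcoeff_mul_trivial => /eqP; rewrite mulf_eq0 orbb => /eqP.
Qed.

(** Lengths add under composition, so the two paths flanking [q] inside [p] must be trivial. *)
Lemma subpath_full q p : subpath q p -> (plength p <= plength q)%N -> q = p.
Proof.
case=> u [v]; case E: pcomp => [r|] //= E'.
rewrite /plength (parrows_comp E') (parrows_comp E) !size_cat addnCA.
rewrite -[X in (_ <= X)%N -> _]addn0 leq_add2l leqn0 addn_eq0.
move=> /andP[/nilP pu /nilP pv].
have {}E' : pcomp (trivial_path (psource u)) r = Some p.
  by rewrite -E'; congr (pcomp _ r); apply: qpath_eq.
have {}E : pcomp q (trivial_path (psource v)) = Some r.
  by rewrite -E; congr (pcomp q _); apply: qpath_eq.
move: E' E; rewrite pcomp1p pcompp1.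
by case: ifP => // _ [->]; case: ifP => // _ [].
Qed.

(** On the cyclic quiver this is convertible to [nakayama], so facts proved for any quiver apply
    there. *)
Definition truncated (m : nat) (m_gt0 : (0 < m)%N) : bound_quiver k :=
  BoundQuiver (@paths_ideal_admissible k Q m m_gt0).

Variables (m : nat) (m_gt0 : (0 < m)%N).
Local Notation A := (truncated m_gt0).

Lemma truncated_residue_eq0 x :
  residue (bq_proper_ideal A) x = 0 <-> long m.+1 x.
Proof.
rewrite -residue0; split => [/residue_eq|h].
  by rewrite subr0 => /paths_idealP.
by apply/residue_eq; rewrite subr0; apply/paths_idealP.
Qed.

(** The element [w - p] has no support in length at most [m], so its coefficient at [p] vanishes,
    which forces [w = p]. *)
Lemma path_class_inj (w p : qpath Q) : (plength p <= m)%N ->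
  path_class A w = path_class A p -> w = p.
Proof.
move=> pm /residue_eq/paths_idealP/(_ p); rewrite ltnS => /(_ pm) /eqP.
rewrite mcoeffB !mcoeff_of_path eqxx subr_eq0.
by case: (w =P p) => // _; rewrite eq_sym oner_eq0.
Qed.

Lemma maximal_path_length p : is_maximal_path A p -> (plength p <= m)%N.
Proof.
case=> h _; rewrite leqNgt; apply/negP => h'; apply: h.
exact/of_path_paths_ideal.
Qed.

Lemma length_maximal_path p : plength p = m -> is_maximal_path A p.
Proof.
move=> pm; split; first by move=> /of_path_paths_ideal; rewrite pm ltnn.
move=> a; split; apply/paths_idealP.
- by rewrite -add1n; apply: long_mul; apply: long_of_path; rewrite ?pm.
- by rewrite -addn1; apply: long_mul; apply: long_of_path; rewrite ?pm.
Qed.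

End TruncatedQuiver.

Lemma radical_square_zero_UMP (k : fieldType) (Q : quiver) :
  is_UMP (truncated k Q (ltn0Sn 0)).
Proof.
move=> p p' /maximal_path_length p1 /maximal_path_length p'1 npp' w w'.
move=> /(path_class_inj p1) -> /(path_class_inj p'1) -> [q [q0 qp qp']].
(* The shared subpath [q] has length at least one and the maximal paths at most one, so both are
   equal to [q]. *)
apply: npp'; congr path_class.
rewrite -(subpath_full qp (leq_trans p1 q0)).
exact: subpath_full qp' (leq_trans p'1 q0).
Qed.

Definition square_zero_product (B : nzRingType) : Prop :=
  forall x y : B, x * x = 0 -> y * y = 0 -> x * y = 0.

Lemma alg_isomorphic_square_zero_product (k : fieldType) (A B : algType k) :
  alg_isomorphic A B -> square_zero_product B -> square_zero_product A.
Proof.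
case=> f /bij_inj finj sq x y x2 y2; apply: finj.
by rewrite rmorphM rmorph0; apply: sq; rewrite -rmorphM (x2, y2) rmorph0.
Qed.

Lemma radical_square_zero_product (k : fieldType) (Q : quiver) :
  square_zero_product (bq_algebra (truncated k Q (ltn0Sn 0))).
Proof.
have long1 (z : bq_algebra (truncated k Q (ltn0Sn 0))) :
    z * z = 0 -> long 1 (repr z : path_algebra k Q).
  by move=> /truncated_residue_eq0 /long_sqr_eq0.
(* By definition [x * y] is the residue of the product of representatives, which is supported in
   length at least 2. *)
move=> x y /long1 lx /long1 ly.
exact/truncated_residue_eq0/(long_mul lx ly).
Qed.

Section CyclicQuiver.
Variables (n : nat) (n_gt0 : (0 < n)%N).
Local Notation Q := (cyclic_quiver n_gt0).

Lemma composable_traject (v : 'I_n) l :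
  @composable Q (v, traject (@ordS n) v l).1 (v, traject (@ordS n) v l).2.
Proof. by elim: l v => //= l IH v; rewrite eqxx IH. Qed.

(** Arrows are numbered by their sources, so the vertices visited from [v] are also the arrows
    followed. *)
Definition cyclic_path (v : 'I_n) l : qpath Q := QPath (composable_traject v l).

Lemma pcomp_cyclic_path (v : 'I_n) i j :
  pcomp (cyclic_path v i) (cyclic_path (iter i (@ordS n) v) j)
  = Some (cyclic_path v (i + j)).
Proof.
have e : ptarget (cyclic_path v i) = iter i (@ordS n) v.
  rewrite /ptarget /parrows /psource /=.
  by elim: i v => //= i IH v; rewrite IH -iterSr.
have [r [-> r1 r2]] := @pcompP Q _ (cyclic_path (iter i (@ordS n) v) j) e.
by congr Some; apply: qpath_eq; rewrite ?r1 // r2 /parrows /= trajectD.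
Qed.

Lemma plength_cyclic_path v l : plength (cyclic_path v l) = l.
Proof. exact: size_traject. Qed.

Lemma ordS_neq (v : 'I_n) : (1 < n)%N -> ordS v != v.
Proof.
move=> n1; apply/eqP => /(congr1 val) /=.
(* Either [v] is the last vertex, whose successor wraps to 0, or no reduction modulo [n] occurs. *)
have := ltn_ord v; rewrite leq_eqVlt => /predU1P[e|h].
  rewrite e modnn => v0; move: n1; rewrite -e -v0; exact/negP.
by rewrite modn_small // => /eqP; rewrite eqn_leq ltnn.
Qed.

Variables (k : fieldType) (m : nat) (m_gt0 : (0 < m)%N).

Lemma nakayama_UMP_eq1 : (1 < n)%N -> is_UMP (nakayama n_gt0 k m_gt0) -> m = 1%N.
Proof.
move=> n1 ump; apply/eqP; rewrite eqn_leq m_gt0 andbT leqNgt; apply/negP => m1.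
pose v := Ordinal n_gt0; pose p := cyclic_path v m.
pose p' := cyclic_path (ordS v) m.
have lp u := plength_cyclic_path u m.
have mp u := @length_maximal_path k Q m m_gt0 _ (lp u).
have npp' : path_class (truncated k Q m_gt0) p
         <> path_class (truncated k Q m_gt0) p'.
  move=> /path_class_inj; rewrite lp leqnn => /(_ isT).
  move=> /(congr1 (@psource Q)) /eqP; rewrite eq_sym.
  exact/negP/ordS_neq.
apply: (ump _ _ (mp v) (mp (ordS v)) npp' p p') => //.
exists (cyclic_path (ordS v) 1); split=> //.
(* The shared arrow is the second one of [p], with [m - 2] arrows after it. *)
- exists (cyclic_path v 1), (cyclic_path (ordS (ordS v)) (m - 2)).
  rewrite (pcomp_cyclic_path (ordS v) 1) /= (pcomp_cyclic_path v 1).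
  by rewrite addnA subnKC.
(* In [p'] it comes first, after a trivial path. *)
- exists (cyclic_path (ordS v) 0), (cyclic_path (ordS (ordS v)) m.-1).
  rewrite (pcomp_cyclic_path (ordS v) 1) /= (pcomp_cyclic_path (ordS v) 0).
  by rewrite add0n add1n prednK.
Qed.

Lemma nakayama_square_zero_product : (1 < n)%N ->
  square_zero_product (bq_algebra (nakayama n_gt0 k m_gt0)) -> m = 1%N.
Proof.
move=> n1 sq; apply/eqP; rewrite eqn_leq m_gt0 andbT.
pose v := Ordinal n_gt0; pose a u := of_path k (cyclic_path u 1).
have aa0 u : a u * a u = 0.
  (* The arrow at [u] is not a loop, so it does not compose with itself. *)
  rewrite mul_of_path /path_mul pcompN //.
  exact: ordS_neq.
pose r := residue (bq_proper_ideal (truncated k Q m_gt0)).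
have r2 u : quot_mul (r (a u)) (r (a u)) = 0.
  by rewrite quot_mulE aa0 residue0.
have := sq (r (a v)) (r (a (ordS v))) (r2 v) (r2 (ordS v)).
rewrite -[_ * _]/(quot_mul _ _) quot_mulE.
move=> /truncated_residue_eq0 /paths_idealP.
rewrite mul_of_path /path_mul (pcomp_cyclic_path v 1 1).
(* A path of length 2 lies in the ideal only if [m + 1 <= 2]. *)
by move=> /of_path_paths_ideal; rewrite plength_cyclic_path.
Qed.

End CyclicQuiver.

Theorem proposition3p1 (k : closedFieldType) (m n : nat)
    (m_gt0 : (0 < m)%N) (n_gt0 : (0 < n)%N) (n_gt1 : (1 < n)%N) :
  is_UMP (nakayama n_gt0 k m_gt0) <->
  alg_isomorphic (bq_algebra (nakayama n_gt0 k m_gt0))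
                 (bq_algebra (nakayama n_gt0 k (ltn0Sn 0))).
Proof.
split=> [/(nakayama_UMP_eq1 n_gt1)|/alg_isomorphic_square_zero_product iso].
  (* The two algebras now differ only in the proof of positivity, so the identity is an
     isomorphism. *)
  move=> m1; subst m; rewrite (bool_irrelevance m_gt0 (ltn0Sn 0)).
  by exists idfun; exists idfun.
have /(nakayama_square_zero_product n_gt1) m1 := iso (@radical_square_zero_product k _).
subst m; rewrite (bool_irrelevance m_gt0 (ltn0Sn 0)).
exact: radical_square_zero_UMP.
Qed.
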